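(* Let $\mathcal{Q}$ be a quantale, let $\Phi$ be a class of limit weights, i.e. of $\mathcal{Q}$-functors $\phi\colon I\to\mathcal{Q}$ with $I$ a $\mathcal{Q}$-category, and let $J$ be the class of all modules $\psi\colon X^{\mathrm{op}}\to\mathcal{Q}$ ($X$ any $\mathcal{Q}$-category) such that the $\mathcal{Q}$-functor $\mathcal{Q}^X\to\mathcal{Q}$, $\alpha\mapsto\bigvee_{x\in X}\alpha(x)\otimes\psi(x)$, preserves $\Phi$-weighted limits. Let $(J,\mathcal{Q})\text{-}\mathbf{Dom}$ be the category whose objects are the $J$-cocomplete, $J$-continuous and open module determined $\mathcal{Q}$-categories and whose morphisms are the $\mathcal{Q}$-functors that reflect open modules. Then the category $(J,\mathcal{Q})\text{-}\mathbf{Dom}$ is self-dual.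
   Context: Quantale: $\mathcal{Q}=(Q,\leqslant,\otimes,\mathbf{1})$ is a complete lattice with a commutative associative operation $\otimes$ with unit $\mathbf{1}$, preserving arbitrary suprema in each variable, such that $\mathbf{1}$ is the top element and $\bot\neq\mathbf{1}$. Its internal hom $\mathcal{Q}(u,v)$ is determined by $w\leqslant\mathcal{Q}(u,v)\iff u\otimes w\leqslant v$. $\mathcal{Q}$-categories: a set $X$ with a map $X(-,-)\colon X\times X\to Q$ such that $\mathbf{1}\leqslant X(x,x)$ and $X(x,y)\otimes X(y,z)\leqslant X(x,z)$. A $\mathcal{Q}$-functor $f\colon X\to Y$ is a map with $X(x,z)\leqslant Y(fx,fz)$. $\mathcal{Q}$ is a $\mathcal{Q}$-category via its internal hom. $X^{\mathrm{op}}(x,y)=X(y,x)$. $Y^X$ is the set of $\mathcal{Q}$-functors $X\to Y$ with $Y^X(f,g)=\bigwedge_{x}Y(fx,gx)$; write $\widehat{X}=\mathcal{Q}^{X^{\mathrm{op}}}$, and $[f,g]$ for the hom of $f,g$ in $\mathcal{Q}^X$ or $\widehat{X}$. Elements of $\widehat X$ are called modules on $X$ (modules from $X$ to the one-point category). $\mathcal{Q}$-functors $L\colon X\to Y$, $R\colon Y\to X$ are adjoint, $L\dashv R$, if $Y(Lx,y)=X(x,Ry)$ for all $x,y$. Yoneda embeddings: $\mathsf{y}_X x=X(-,x)\in\widehat X$ and $\lambda_X(x)=X(x,-)\in\mathcal{Q}^X$. The class $J$: explicitly, a module $\psi\colon X^{\mathrm{op}}\to\mathcal{Q}$ belongs to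 $J$ iff for every $\phi\colon I\to\mathcal{Q}$ in $\Phi$ and every $\mathcal{Q}$-functor $I\to\mathcal{Q}^X$, $i\mapsto\alpha_i$, $$\bigwedge_{i\in I}\mathcal{Q}\Big(\phi(i),\bigvee_{x\in X}\alpha_i(x)\otimes\psi(x)\Big)=\bigvee_{x\in X}\Big(\bigwedge_{i\in I}\mathcal{Q}(\phi(i),\alpha_i(x))\Big)\otimes\psi(x).$$ $JX\subseteq\widehat X$ denotes the sub-$\mathcal{Q}$-category (with the structure of $\widehat X$) of modules on $X$ belonging to $J$; it contains all $\mathsf{y}_Xx$. $J$-cocompleteness: $X$ is $J$-cocomplete if $\mathsf{y}_X\colon X\to JX$ has a left adjoint $\mathsf{S}_X\colon JX\to X$ (i.e. $X(\mathsf{S}_X\phi,x)=\widehat X(\phi,\mathsf{y}_Xx)$). For $J$-cocomplete $X$, a $\mathcal{Q}$-functor $\alpha\colon X\to\mathcal{Q}$ is $J$-cocontinuous if it preserves $J$-weighted colimits, equivalently $\alpha(\mathsf{S}_X\phi)=\bigvee_{x\in X}\alpha(x)\otimes\phi(x)$ for all $\phi\in JX$. $J$-continuity: a $J$-cocomplete $X$ is $J$-continuous if $\mathsf{S}_X\colon JX\to X$ has a left adjoint. The way-below module of a $J$-cocomplete $X$ is $\Downarrow_X(x,y)=\bigwedge_{\phi\in JX}\mathcal{Q}(X(y,\mathsf{S}_X\phi),\phi(x))$; when $X$ is $J$-continuous, $y\mapsto\Downarrow_X(-,y)$ is the left adjoint of $\mathsf{S}_X$. Open modules: $FX$ is the set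 of $\mathcal{Q}$-functors $\alpha\colon X\to\mathcal{Q}$ that are $J$-cocontinuous and belong to $J(X^{\mathrm{op}})$, with the structure inherited from $\mathcal{Q}^X$. Elements of $FX$ are called open modules. A $J$-continuous $X$ is open module determined if $\Downarrow_X(x,y)=\bigvee_{\alpha\in FX}\big(\alpha(y)\otimes[\alpha,\lambda_X(x)]\big)$ for all $x,y\in X$. A $\mathcal{Q}$-functor $f\colon X\to Y$ reflects open modules if $\alpha\circ f\in FX$ for every $\alpha\in FY$. Self-dual means equivalent to its own opposite category.
   Formalization: With non-separated objects and literal equality of morphisms self-duality fails; it is proved for all objects with Q-functors identified when isomorphic in Y^X, and also for separated objects with literal equality of Q-functors. *)

(* Defs.v *)
From HB Require Import structures.
From mathcomp Require Import all_boot all_order.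
From mathcomp Require Import boolp classical_sets.
Set Implicit Arguments.
Unset Strict Implicit.
Unset Printing Implicit Defensive.
Import Order.TTheory.
Local Open Scope classical_set_scope.
Local Open Scope order_scope.

(* Commutative, unital and integral (the unit is the top element), with
   bottom distinct from top; [qsup set0] is the bottom element. *)
HB.mixin Record isQuantale (d : Order.disp_t) Q of Order.POrder d Q := {
  qsup : set Q -> Q;
  qtens : Q -> Q -> Q;
  qone : Q;
  qsup_supremum : forall A : set Q, supremums A (qsup A);
  qtensA : associative qtens;
  qtensC : commutative qtens;
  qtens1 : left_id qone qtens;
  qtens_sup : forall (u : Q) (A : set Q),
    qtens u (qsup A) = qsup [set qtens u v | v in A];
  qone_top : forall u : Q, (u <= qone)%O;
  qone_neq_bot : qsup set0 <> qone
}.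

#[short(type="quantaleType")]
HB.structure Definition Quantale d :=
  {Q of isQuantale d Q & Order.POrder d Q}.

Notation "u ⊗ v" := (qtens u v) (at level 40, left associativity).
Notation "𝟏" := qone (at level 0).

Definition qinf (d : Order.disp_t) (Q : quantaleType d) (A : set Q) : Q :=
  qsup (lbound A).

Definition qSup (d : Order.disp_t) (Q : quantaleType d) (T : Type)
  (f : T -> Q) : Q := qsup (range f).
Definition qInf (d : Order.disp_t) (Q : quantaleType d) (T : Type)
  (f : T -> Q) : Q := qinf (range f).
Notation "⋁ x , F" := (qSup (fun x => F))
  (at level 200, x binder, right associativity).
Notation "⋀ x , F" := (qInf (fun x => F))
  (at level 200, x binder, right associativity).

(* The internal hom Q(u, v), characterized by [le_qres]. *)
Definition qres (d : Order.disp_t) (Q : quantaleType d) (u v : Q) : Q :=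
  qsup [set w | u ⊗ w <= v].

Lemma qsup_le (d : Order.disp_t) (Q : quantaleType d) (A : set Q) (w : Q) :
  qsup A <= w <-> forall v, A v -> v <= w.
Proof.
have [ub lub] := qsup_supremum A; split=> [le_w v Av|]; last exact: lub.
exact: le_trans (ub v Av) le_w.
Qed.

Lemma le_qinf (d : Order.disp_t) (Q : quantaleType d) (A : set Q) (w : Q) :
  w <= qinf A <-> forall v, A v -> w <= v.
Proof.
split=> [le_w v Av|lbw]; last by have [ub _] := qsup_supremum (lbound A); apply: ub.
by apply: (le_trans le_w); apply/qsup_le => u; apply.
Qed.

Lemma qSup_le (d : Order.disp_t) (Q : quantaleType d) (T : Type)
    (f : T -> Q) (w : Q) : (⋁ x, f x) <= w <-> forall x, f x <= w.
Proof.
apply: (iff_trans (qsup_le _ _)); split=> [h x|h _ [x _ <-]]; last exact: h.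
by apply: h; exists x.
Qed.

Lemma le_qInf (d : Order.disp_t) (Q : quantaleType d) (T : Type)
    (f : T -> Q) (w : Q) : w <= (⋀ x, f x) <-> forall x, w <= f x.
Proof.
apply: (iff_trans (le_qinf _ _)); split=> [h x|h _ [x _ <-]]; last exact: h.
by apply: h; exists x.
Qed.

Lemma qSup_ub (d : Order.disp_t) (Q : quantaleType d) (T : Type)
    (f : T -> Q) (x : T) : f x <= ⋁ x, f x.
Proof. exact: (qSup_le f _).1 (lexx _) x. Qed.

Lemma qInf_lb (d : Order.disp_t) (Q : quantaleType d) (T : Type)
    (f : T -> Q) (x : T) : (⋀ x, f x) <= f x.
Proof. exact: (le_qInf f _).1 (lexx _) x. Qed.

Lemma qtens_Sup (d : Order.disp_t) (Q : quantaleType d) (T : Type)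
    (u : Q) (f : T -> Q) : u ⊗ (⋁ x, f x) = ⋁ x, u ⊗ f x.
Proof. by rewrite /qSup qtens_sup image_comp. Qed.

Lemma qSup_tens (d : Order.disp_t) (Q : quantaleType d) (T : Type)
    (u : Q) (f : T -> Q) : (⋁ x, f x) ⊗ u = ⋁ x, f x ⊗ u.
Proof. by rewrite qtensC qtens_Sup; congr qSup; apply/funext => x; rewrite qtensC. Qed.

Lemma qtens_monor (d : Order.disp_t) (Q : quantaleType d) (u v w : Q) :
  v <= w -> u ⊗ v <= u ⊗ w.
Proof.
move=> le_vw; have -> : w = ⋁ b : bool, if b then v else w.
  apply/le_anti/andP; split; first exact: (qSup_ub (fun b : bool => if b then v else w) false).
  by apply/qSup_le => -[].
rewrite qtens_Sup.
exact: (qSup_ub (fun b : bool => u ⊗ (if b then v else w)) true).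
Qed.

Lemma qtens_mono (d : Order.disp_t) (Q : quantaleType d) (u u' v v' : Q) :
  u <= u' -> v <= v' -> u ⊗ v <= u' ⊗ v'.
Proof.
move=> leu lev; apply: (le_trans (qtens_monor u lev)).
by rewrite qtensC [leRHS]qtensC; exact: qtens_monor.
Qed.

Lemma le_qres (d : Order.disp_t) (Q : quantaleType d) (u v w : Q) :
  w <= qres u v <-> u ⊗ w <= v.
Proof.
split=> [le_w|le_v]; last by have [ub _] := qsup_supremum [set w | u ⊗ w <= v]; apply: ub.
apply: (le_trans (qtens_monor u le_w)); rewrite qtens_sup.
by apply/qsup_le => _ [z + <-].
Qed.

Lemma qres_ev (d : Order.disp_t) (Q : quantaleType d) (u v : Q) :
  u ⊗ qres u v <= v.
Proof. exact/le_qres. Qed.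

Lemma qle_antiP (d : Order.disp_t) (Q : quantaleType d) (u v : Q) :
  (forall w, w <= u <-> w <= v) -> u = v.
Proof. by move=> h; apply/le_anti/andP; split; apply/h. Qed.

Lemma eq_qSup (d : Order.disp_t) (Q : quantaleType d) (T : Type)
  (f g : T -> Q) : (forall x, f x = g x) -> (⋁ x, f x) = ⋁ x, g x.
Proof. by move=> /funext ->. Qed.

Lemma eq_qInf (d : Order.disp_t) (Q : quantaleType d) (T : Type)
  (f g : T -> Q) : (forall x, f x = g x) -> (⋀ x, f x) = ⋀ x, g x.
Proof. by move=> /funext ->. Qed.

Lemma exchange_qSup (d : Order.disp_t) (Q : quantaleType d) (S T : Type)
    (f : S -> T -> Q) : (⋁ x, ⋁ y, f x y) = ⋁ y, ⋁ x, f x y.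
Proof.
apply/le_anti/andP; split; apply/qSup_le => x; apply/qSup_le => y.
  apply: (le_trans _ (qSup_ub (fun y => ⋁ x, f x y) y)).
  exact: (qSup_ub (f^~ y)).
apply: (le_trans _ (qSup_ub (fun x => ⋁ y, f x y) y)).
exact: (qSup_ub (f y)).
Qed.

Lemma exchange_qInf (d : Order.disp_t) (Q : quantaleType d) (S T : Type)
    (f : S -> T -> Q) : (⋀ x, ⋀ y, f x y) = ⋀ y, ⋀ x, f x y.
Proof.
apply: qle_antiP => w; split=> /le_qInf h; apply/le_qInf => y;
  by apply/le_qInf => x; exact: ((le_qInf _ _).1 (h x)).
Qed.

Lemma qres1l (d : Order.disp_t) (Q : quantaleType d) (v : Q) : qres 𝟏 v = v.
Proof.
apply: qle_antiP => w; apply: (iff_trans (le_qres _ _ _)).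
by rewrite qtens1; exact: iff_refl.
Qed.

Lemma qres_res (d : Order.disp_t) (Q : quantaleType d) (u v w : Q) :
  qres u (qres v w) = qres (u ⊗ v) w.
Proof.
apply: qle_antiP => t; split.
  by move=> /le_qres/le_qres h; apply/le_qres; rewrite [u ⊗ v]qtensC -qtensA.
move=> /le_qres; rewrite [u ⊗ v]qtensC -qtensA => h.
by apply/le_qres; apply/le_qres.
Qed.

Lemma qresCA (d : Order.disp_t) (Q : quantaleType d) (u v w : Q) :
  qres u (qres v w) = qres v (qres u w).
Proof. by rewrite !qres_res qtensC. Qed.

Lemma qres_Inf (d : Order.disp_t) (Q : quantaleType d) (T : Type)
    (u : Q) (f : T -> Q) : qres u (⋀ x, f x) = ⋀ x, qres u (f x).
Proof.
apply: qle_antiP => w; split.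
  by move=> /le_qres/le_qInf h; apply/le_qInf => x; apply/le_qres.
by move=> /le_qInf h; apply/le_qres/le_qInf => x; apply/le_qres.
Qed.

Lemma qSup_res (d : Order.disp_t) (Q : quantaleType d) (T : Type)
    (v : Q) (f : T -> Q) : qres (⋁ x, f x) v = ⋀ x, qres (f x) v.
Proof.
apply: qle_antiP => w; split.
  move=> /le_qres; rewrite qSup_tens => /qSup_le h.
  by apply/le_qInf => x; apply/le_qres.
move=> /le_qInf h; apply/le_qres; rewrite qSup_tens; apply/qSup_le => x.
exact/le_qres.
Qed.

Lemma qone_res (d : Order.disp_t) (Q : quantaleType d) (u v : Q) :
  𝟏 <= qres u v <-> u <= v.
Proof.
apply: (iff_trans (le_qres _ _ _)).
by rewrite qtensC qtens1; exact: iff_refl.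
Qed.

Record qcat (d : Order.disp_t) (Q : quantaleType d) := QCat {
  qob :> Type;
  hom : qob -> qob -> Q;
  hom_id : forall x, 𝟏 <= hom x x;
  hom_comp : forall x y z, hom x y ⊗ hom y z <= hom x z
}.
Arguments hom {d Q} X x y : rename.

Record qfun (d : Order.disp_t) (Q : quantaleType d) (X Y : qcat Q) := QFun {
  qmap :> X -> Y;
  qmap_hom : forall x z, hom X x z <= hom Y (qmap x) (qmap z)
}.

Lemma qfun_ext (d : Order.disp_t) (Q : quantaleType d) (X Y : qcat Q)
    (f g : qfun X Y) : (forall x, f x = g x) -> f = g.
Proof.
case: f g => [f fP] [g gP] /= /funext eq_fg; subst g.
by rewrite (Prop_irrelevance fP gP).
Qed.

Definition qfun_id (d : Order.disp_t) (Q : quantaleType d) (X : qcat Q) :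
  qfun X X := QFun (fun x z => lexx (hom X x z)).

Definition qcomp (d : Order.disp_t) (Q : quantaleType d) (X Y Z : qcat Q)
    (g : qfun Y Z) (f : qfun X Y) : qfun X Z :=
  QFun (fun x z => le_trans (qmap_hom f x z) (qmap_hom g (f x) (f z))).

Definition opcat (d : Order.disp_t) (Q : quantaleType d) (X : qcat Q) :
  qcat Q.
Proof.
refine (@QCat d Q X (fun x y => hom X y x) (@hom_id _ _ X) _).
by move=> x y z; rewrite qtensC; exact: hom_comp.
Defined.

Definition qop (d : Order.disp_t) (Q : quantaleType d) (X Y : qcat Q)
    (f : qfun X Y) : qfun (opcat X) (opcat Y) :=
  @QFun d Q (opcat X) (opcat Y) f (fun x z => qmap_hom f z x).

Definition qself (d : Order.disp_t) (Q : quantaleType d) : qcat Q.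
Proof.
refine (@QCat d Q Q (@qres d Q) _ _) => [x|x y z].
  by apply/le_qres; rewrite qtensC qtens1.
apply/le_qres; rewrite qtensA; apply: le_trans (qres_ev y z).
by apply: qtens_mono (qres_ev x y) _.
Defined.

(* Y^X *)
Definition qfuncat (d : Order.disp_t) (Q : quantaleType d) (X Y : qcat Q) :
  qcat Q.
Proof.
refine (@QCat d Q (qfun X Y) (fun f g => ⋀ x, hom Y (f x) (g x)) _ _).
  by move=> f; apply/le_qInf => x; exact: hom_id.
move=> f g h; apply/le_qInf => x; apply: le_trans (hom_comp (f x) (g x) (h x)).
apply: qtens_mono; first exact: (qInf_lb (fun x => hom Y (f x) (g x))).
exact: (qInf_lb (fun x => hom Y (g x) (h x))).
Defined.

(* Q^X *)
Definition qcopsh (d : Order.disp_t) (Q : quantaleType d) (X : qcat Q) :=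
  qfuncat X (qself Q).

(* The modules on X *)
Definition qmod (d : Order.disp_t) (Q : quantaleType d) (X : qcat Q) :=
  qcopsh (opcat X).

Definition fullsub (d : Order.disp_t) (Q : quantaleType d) (X : qcat Q)
    (P : X -> Prop) : qcat Q :=
  @QCat d Q {x : X | P x} (fun x y => hom X (sval x) (sval y))
    (fun x => hom_id (sval x))
    (fun x y z => hom_comp (sval x) (sval y) (sval z)).

Definition adjoint (d : Order.disp_t) (Q : quantaleType d) (X Y : qcat Q)
    (L : qfun X Y) (R : qfun Y X) :=
  forall x y, hom Y (L x) y = hom X x (R y).

Definition isoob (d : Order.disp_t) (Q : quantaleType d) (X : qcat Q)
  (x y : X) := 𝟏 <= hom X x y /\ 𝟏 <= hom X y x.

Definition separated (d : Order.disp_t) (Q : quantaleType d) (X : qcat Q) :=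
  forall x y : X, isoob x y -> x = y.

(* The elements X(x, -) of Q^X and X(-, x) of Q^(X^op) *)
Definition lambda (d : Order.disp_t) (Q : quantaleType d) (X : qcat Q)
  (x : X) : qcopsh X.
Proof.
refine (@QFun d Q X (qself Q) (hom X x) _) => y z.
by apply/le_qres; exact: hom_comp.
Defined.

Definition yoneda (d : Order.disp_t) (Q : quantaleType d) (X : qcat Q)
  (x : X) : qmod X := @lambda d Q (opcat X) x.

Definition is_wlim (d : Order.disp_t) (Q : quantaleType d) (I X : qcat Q)
    (phi : qfun I (qself Q)) (D : qfun I X) (l : X) :=
  forall x, hom X x l = hom (qcopsh I) phi (qcomp (lambda x) D).

Definition is_wcolim (d : Order.disp_t) (Q : quantaleType d) (I X : qcat Q)
    (psi : qmod I) (D : qfun I X) (c : X) :=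
  forall x, hom X c x = hom (qmod I) psi (qcomp (yoneda x) (qop D)).

Definition preserves_wlim (d : Order.disp_t) (Q : quantaleType d)
    (I X Y : qcat Q) (phi : qfun I (qself Q)) (F : qfun X Y) :=
  forall (D : qfun I X) (l : X),
    is_wlim phi D l -> is_wlim phi (qcomp F D) (F l).

Definition preserves_wcolim (d : Order.disp_t) (Q : quantaleType d)
    (I X Y : qcat Q) (psi : qmod I) (F : qfun X Y) :=
  forall (D : qfun I X) (c : X),
    is_wcolim psi D c -> is_wcolim psi (qcomp F D) (F c).

Definition limit_weights (d : Order.disp_t) (Q : quantaleType d) :=
  forall I : qcat Q, qfun I (qself Q) -> Prop.

Lemma qmod_act_subproof (d : Order.disp_t) (Q : quantaleType d) (X : qcat Q)
    (psi : qmod X) (a b : qcopsh X) :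
  hom (qcopsh X) a b <=
  hom (qself Q) (⋁ x : X, a x ⊗ psi x) (⋁ x : X, b x ⊗ psi x).
Proof.
apply/le_qres; rewrite qSup_tens; apply/qSup_le => x.
apply: le_trans (qSup_ub (fun x : X => b x ⊗ psi x) x).
rewrite -qtensA [psi x ⊗ _]qtensC qtensA; apply: qtens_mono => //.
by apply/le_qres; exact: (qInf_lb (fun x => hom (qself Q) (a x) (b x))).
Qed.

Definition qmod_act (d : Order.disp_t) (Q : quantaleType d) (X : qcat Q)
    (psi : qmod X) : qfun (qcopsh X) (qself Q) :=
  @QFun d Q (qcopsh X) (qself Q) (fun a => ⋁ x : X, a x ⊗ psi x)
    (qmod_act_subproof psi).

Definition inJ (d : Order.disp_t) (Q : quantaleType d)
    (Phi : limit_weights Q) (X : qcat Q) (psi : qmod X) :=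
  forall (I : qcat Q) (phi : qfun I (qself Q)), Phi I phi ->
    preserves_wlim phi (qmod_act psi).

(* Weighted limits in Q and in Q^X, and weighted colimits in Q, are given by
   the usual formulas, which makes membership in J explicit ([inJE]). *)
Lemma wlim_qself (d : Order.disp_t) (Q : quantaleType d) (I : qcat Q)
    (phi D : qfun I (qself Q)) (l : qself Q) :
  is_wlim phi D l <-> l = ⋀ i, qres (phi i) (D i).
Proof.
split=> [lim|-> x] /=.
  have := lim 𝟏; rewrite /= qres1l => ->.
  by apply: eq_qInf => i; rewrite /= qres1l.
by rewrite qres_Inf; apply: eq_qInf => i; rewrite /= qresCA.
Qed.

Lemma wcolim_qself (d : Order.disp_t) (Q : quantaleType d) (I : qcat Q)
    (psi : qmod I) (D : qfun I (qself Q)) (c : qself Q) :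
  is_wcolim psi D c <-> c = ⋁ i : I, D i ⊗ psi i.
Proof.
have key (x : Q) : qres (⋁ i : I, D i ⊗ psi i) x =
    hom (qmod I) psi (qcomp (@yoneda d Q (qself Q) x) (qop D)).
  by rewrite qSup_res; apply: eq_qInf => i; rewrite /= qtensC -qres_res.
split=> [colim|-> x]; last exact: key.
have {key colim}E (x : Q) : qres c x = qres (⋁ i : I, D i ⊗ psi i) x.
  by rewrite key -colim.
apply/le_anti/andP; split; apply/qone_res.
  by rewrite E; apply/qone_res.
by rewrite -E; apply/qone_res.
Qed.

Lemma separated_qself (d : Order.disp_t) (Q : quantaleType d) :
  separated (qself Q).
Proof.
move=> u v [/qone_res le_uv /qone_res le_vu].
by apply/le_anti/andP.
Qed.

Lemma separated_qfuncat (d : Order.disp_t) (Q : quantaleType d)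
    (X Y : qcat Q) : separated Y -> separated (qfuncat X Y).
Proof.
move=> sepY f g [/le_qInf le_fg /le_qInf le_gf]; apply: qfun_ext => x.
by apply: sepY; split.
Qed.

Lemma wlim_unique (d : Order.disp_t) (Q : quantaleType d) (I X : qcat Q)
    (phi : qfun I (qself Q)) (D : qfun I X) (l l' : X) :
  is_wlim phi D l -> is_wlim phi D l' -> isoob l l'.
Proof.
move=> lim lim'; split; first by rewrite lim' -lim hom_id.
by rewrite lim -lim' hom_id.
Qed.

Lemma wcolim_unique (d : Order.disp_t) (Q : quantaleType d) (I X : qcat Q)
    (psi : qmod I) (D : qfun I X) (c c' : X) :
  is_wcolim psi D c -> is_wcolim psi D c' -> isoob c c'.
Proof.
move=> col col'; split; first by rewrite col -col' hom_id.
by rewrite col' -col hom_id.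
Qed.

Definition wlim_pt (d : Order.disp_t) (Q : quantaleType d) (I X : qcat Q)
  (phi : qfun I (qself Q)) (a : qfun I (qcopsh X)) : qcopsh X.
Proof.
refine (@QFun d Q X (qself Q) (fun x => ⋀ i, qres (phi i) (a i x)) _) => x z.
apply/le_qres/le_qInf => i; apply/le_qres; rewrite qtensA.
apply: (@le_trans _ _ (a i x ⊗ hom X x z)).
  by apply: qtens_mono => //; apply/le_qres; exact: (qInf_lb _ i).
by apply/le_qres; exact: (qmap_hom (a i)).
Defined.

Lemma wlim_qcopsh (d : Order.disp_t) (Q : quantaleType d) (I X : qcat Q)
    (phi : qfun I (qself Q)) (a : qfun I (qcopsh X)) (l : qcopsh X) :
  is_wlim phi a l <-> forall x, l x = ⋀ i, qres (phi i) (a i x).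
Proof.
have pw (l0 : qcopsh X) :
    (forall x, l0 x = ⋀ i, qres (phi i) (a i x)) -> is_wlim phi a l0.
  move=> E b; rewrite /=.
  transitivity (⋀ x, ⋀ i, qres (b x) (qres (phi i) (a i x))).
    by apply: eq_qInf => x; rewrite E qres_Inf.
  rewrite exchange_qInf; apply: eq_qInf => i; rewrite qres_Inf.
  by apply: eq_qInf => x; rewrite qresCA.
split=> [lim|]; last exact: pw.
have -> // : l = wlim_pt phi a.
apply: (separated_qfuncat (@separated_qself d Q)).
exact: (wlim_unique lim (pw (wlim_pt phi a) (fun=> erefl))).
Qed.

Lemma inJE (d : Order.disp_t) (Q : quantaleType d) (Phi : limit_weights Q)
    (X : qcat Q) (psi : qmod X) :
  inJ Phi psi <->
  forall (I : qcat Q) (phi : qfun I (qself Q)), Phi I phi ->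
    forall a : qfun I (qcopsh X),
    (⋀ i : I, qres (phi i) (⋁ x : X, a i x ⊗ psi x)) =
    ⋁ x : X, (⋀ i : I, qres (phi i) (a i x)) ⊗ psi x.
Proof.
split=> [J I phi Phi_phi a|E I phi Phi_phi a l lim].
  have lim := (wlim_qcopsh phi a (wlim_pt phi a)).2 (fun=> erefl).
  by have /wlim_qself <- := J I phi Phi_phi a _ lim.
apply/wlim_qself; rewrite E //.
by apply: eq_qSup => x; rewrite ((wlim_qcopsh _ _ _).1 lim).
Qed.

Definition Jcat (d : Order.disp_t) (Q : quantaleType d)
    (Phi : limit_weights Q) (X : qcat Q) : qcat Q :=
  @fullsub d Q (qmod X) (@inJ d Q Phi X).

Lemma hom_act (d : Order.disp_t) (Q : quantaleType d) (X : qcat Q)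
    (a : qcopsh X) (x : X) : (⋁ z : X, a z ⊗ hom X z x) = a x.
Proof.
apply/le_anti/andP; split.
  by apply/qSup_le => z; apply/le_qres; exact: (qmap_hom a).
apply: le_trans (qSup_ub (fun z => a z ⊗ hom X z x) x).
by rewrite -[leLHS]qtens1 qtensC; apply: qtens_monor; exact: hom_id.
Qed.

Lemma yoneda_inJ (d : Order.disp_t) (Q : quantaleType d)
    (Phi : limit_weights Q) (X : qcat Q) (x : X) : inJ Phi (yoneda x).
Proof.
apply/inJE => I phi _ a; rewrite (hom_act (wlim_pt phi a) x).
by apply: eq_qInf => i; rewrite (hom_act (a i) x).
Qed.

(* y_X : X -> JX *)
Definition yonedaJ (d : Order.disp_t) (Q : quantaleType d)
    (Phi : limit_weights Q) (X : qcat Q) : qfun X (Jcat Phi X).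
Proof.
refine (@QFun d Q X (Jcat Phi X)
  (fun x => exist (@inJ d Q Phi X) (yoneda x) (yoneda_inJ x)) _) => x y.
by apply/le_qInf => z; apply/le_qres; exact: (@hom_comp d Q X).
Defined.

Definition J_cocomplete (d : Order.disp_t) (Q : quantaleType d)
    (Phi : limit_weights Q) (X : qcat Q) :=
  exists S : qfun (Jcat Phi X) X, adjoint S (yonedaJ Phi X).

Definition J_continuous (d : Order.disp_t) (Q : quantaleType d)
    (Phi : limit_weights Q) (X : qcat Q) :=
  exists2 S : qfun (Jcat Phi X) X, adjoint S (yonedaJ Phi X) &
    exists L : qfun X (Jcat Phi X), adjoint L S.

Definition J_cocontinuous (d : Order.disp_t) (Q : quantaleType d)
    (Phi : limit_weights Q) (X Y : qcat Q) (F : qfun X Y) :=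
  forall (I : qcat Q) (psi : qmod I), inJ Phi psi -> preserves_wcolim psi F.

(* The left Kan extension of [psi] along [D], which reduces J-weighted
   colimits in [X] to suprema of elements of JX. *)
Definition qlan (d : Order.disp_t) (Q : quantaleType d) (I X : qcat Q)
  (psi : qmod I) (D : qfun I X) : qmod X.
Proof.
refine (@QFun d Q (opcat X) (qself Q)
  (fun x => ⋁ i : I, hom X x (D i) ⊗ psi i) _) => x z.
apply/le_qres; rewrite qSup_tens; apply/qSup_le => i.
apply: le_trans (qSup_ub (fun i => hom X z (D i) ⊗ psi i) i).
rewrite qtensC qtensA; by apply: qtens_mono => //; exact: (@hom_comp d Q X).
Defined.

Lemma qlan_act (d : Order.disp_t) (Q : quantaleType d) (I X : qcat Q)
    (psi : qmod I) (D : qfun I X) (a : qcopsh X) :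
  (⋁ x : X, a x ⊗ qlan psi D x) = ⋁ i : I, a (D i) ⊗ psi i.
Proof.
transitivity (⋁ x : X, ⋁ i : I, a x ⊗ hom X x (D i) ⊗ psi i).
  by apply: eq_qSup => x; rewrite qtens_Sup; apply: eq_qSup => i; rewrite qtensA.
rewrite exchange_qSup; apply: eq_qSup => i.
by rewrite -(hom_act a (D i)) qSup_tens.
Qed.

Lemma qlan_inJ (d : Order.disp_t) (Q : quantaleType d)
    (Phi : limit_weights Q) (I X : qcat Q) (psi : qmod I) (D : qfun I X) :
  inJ Phi psi -> inJ Phi (qlan psi D).
Proof.
move=> /inJE J; apply/inJE => K phi Phi_phi a.
rewrite (qlan_act psi D (wlim_pt phi a)).
transitivity (⋀ k : K, qres (phi k) (⋁ i : I, a k (D i) ⊗ psi i)).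
  by apply: eq_qInf => k; rewrite qlan_act.
have aDP k k' : hom K k k' <= hom (qcopsh I) (qcomp (a k) D) (qcomp (a k') D).
  apply: (le_trans (qmap_hom a k k')); apply/le_qInf => i.
  exact: (qInf_lb _ (D i)).
exact: (J K phi Phi_phi (@QFun d Q K (qcopsh I) (fun k => qcomp (a k) D) aDP)).
Qed.

Lemma wcolim_S (d : Order.disp_t) (Q : quantaleType d)
    (Phi : limit_weights Q) (I X : qcat Q) (S : qfun (Jcat Phi X) X)
    (psi : qmod I) (D : qfun I X) (Jpsi : inJ Phi psi) :
  adjoint S (yonedaJ Phi X) ->
  is_wcolim psi D (S (exist (@inJ d Q Phi X) (qlan psi D) (qlan_inJ D Jpsi))).
Proof.
move=> adjS x; rewrite adjS /=.
transitivity (⋀ z : X, ⋀ i : I, qres (psi i) (qres (hom X z (D i)) (hom X z x))).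
  by apply: eq_qInf => z; rewrite qSup_res; apply: eq_qInf => i;
    rewrite qtensC -qres_res.
rewrite exchange_qInf; apply: eq_qInf => i; rewrite -qres_Inf; congr qres.
apply/le_anti/andP; split.
  apply: (le_trans (qInf_lb _ (D i))); rewrite -[leRHS]qres1l.
  apply/le_qres; apply: le_trans (qres_ev (hom X (D i) (D i)) _).
  by apply: qtens_mono => //; exact: hom_id.
by apply/le_qInf => z; apply/le_qres; exact: hom_comp.
Qed.

Lemma J_cocontinuousE (d : Order.disp_t) (Q : quantaleType d)
    (Phi : limit_weights Q) (X : qcat Q) (S : qfun (Jcat Phi X) X)
    (a : qcopsh X) : adjoint S (yonedaJ Phi X) ->
  J_cocontinuous Phi a <->
  forall phi : Jcat Phi X, a (S phi) = ⋁ x : X, a x ⊗ sval phi x.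
Proof.
move=> adjS; split=> [cocont [phi Jphi]|E I psi Jpsi D c colim].
  have colS : is_wcolim phi (qfun_id X) (S (exist _ phi Jphi)).
    by move=> x; rewrite adjS.
  by have /wcolim_qself := cocont X phi Jphi _ _ colS.
apply/wcolim_qself; have [cS Sc] := wcolim_unique colim (wcolim_S D Jpsi adjS).
rewrite -(qlan_act psi D a) -(E (exist _ _ (qlan_inJ D Jpsi))).
by apply: separated_qself; split; apply: le_trans (qmap_hom a _ _).
Qed.

(* The way-below module does not depend on the choice of [S], which is unique
   up to isomorphism. *)
Definition waybelow (d : Order.disp_t) (Q : quantaleType d)
    (Phi : limit_weights Q) (X : qcat Q) (S : qfun (Jcat Phi X) X) (x y : X) : Q :=
  ⋀ phi : Jcat Phi X, qres (hom X y (S phi)) (sval phi x).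

(* An element of Q^X seen as a module on X^op: [opcat (opcat X)] and [X] have
   the same objects and homs but are not convertible. *)
Definition qmod_op (d : Order.disp_t) (Q : quantaleType d) (X : qcat Q)
    (a : qcopsh X) : qmod (opcat X) :=
  @QFun d Q (opcat (opcat X)) (qself Q) a (qmap_hom a).

Definition open_module (d : Order.disp_t) (Q : quantaleType d)
    (Phi : limit_weights Q) (X : qcat Q) (a : qcopsh X) :=
  J_cocontinuous Phi a /\ inJ Phi (qmod_op a).

(* FX *)
Definition Fcat (d : Order.disp_t) (Q : quantaleType d)
    (Phi : limit_weights Q) (X : qcat Q) : qcat Q :=
  @fullsub d Q (qcopsh X) (@open_module d Q Phi X).

Definition open_module_determined (d : Order.disp_t) (Q : quantaleType d)
    (Phi : limit_weights Q) (X : qcat Q) :=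
  forall S : qfun (Jcat Phi X) X, adjoint S (yonedaJ Phi X) ->
  forall x y : X,
    waybelow S x y =
    ⋁ a : Fcat Phi X, sval a y ⊗ hom (qcopsh X) (sval a) (lambda x).

Definition reflects_open (d : Order.disp_t) (Q : quantaleType d)
    (Phi : limit_weights Q) (X Y : qcat Q) (f : qfun X Y) :=
  forall a : qcopsh Y, open_module Phi a -> open_module Phi (qcomp a f).

(* Hom-sets carry an equivalence relation [ceq], which plays the role of
   equality of morphisms; an ordinary category has [ceq := eq]. *)
Record category := Category {
  cob :> Type;
  cmor : cob -> cob -> Type;
  ceq : forall A B, cmor A B -> cmor A B -> Prop;
  cid : forall A, cmor A A;
  ccomp : forall A B C, cmor B C -> cmor A B -> cmor A C;
  ceq_refl : forall A B (f : cmor A B), ceq f f;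
  ceq_sym : forall A B (f g : cmor A B), ceq f g -> ceq g f;
  ceq_trans : forall A B (f g h : cmor A B), ceq f g -> ceq g h -> ceq f h;
  ceq_comp : forall A B C (g g' : cmor B C) (f f' : cmor A B),
    ceq g g' -> ceq f f' -> ceq (ccomp g f) (ccomp g' f');
  ccomp_idl : forall A B (f : cmor A B), ceq (ccomp (cid B) f) f;
  ccomp_idr : forall A B (f : cmor A B), ceq (ccomp f (cid A)) f;
  ccompA : forall A B C D (h : cmor C D) (g : cmor B C) (f : cmor A B),
    ceq (ccomp h (ccomp g f)) (ccomp (ccomp h g) f)
}.
Arguments cmor : clear implicits.
Arguments cid {c} A.

Definition opposite (C : category) : category.
Proof.
refine (@Category C (fun A B => cmor C B A) (fun A B f g => ceq f g)
  (fun A => cid A) (fun X Y Z g f => ccomp f g) _ _ _ _ _ _ _) => /=.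
- by move=> *; exact: ceq_refl.
- by move=> *; exact: ceq_sym.
- by move=> A B f g h; exact: ceq_trans.
- by move=> *; exact: ceq_comp.
- by move=> *; exact: ccomp_idr.
- by move=> *; exact: ccomp_idl.
- by move=> *; apply: ceq_sym; exact: ccompA.
Defined.

Record functor (C D : category) := Functor {
  fob :> C -> D;
  fmap : forall A B, cmor C A B -> cmor D (fob A) (fob B);
  fmap_ceq : forall A B (f g : cmor C A B), ceq f g -> ceq (fmap f) (fmap g);
  fmap_id : forall A, ceq (fmap (cid A)) (cid (fob A));
  fmap_comp : forall X Y Z (g : cmor C Y Z) (f : cmor C X Y),
    ceq (fmap (ccomp g f)) (ccomp (fmap g) (fmap f))
}.

Definition functor_id (C : category) : functor C C :=
  @Functor C C id (fun A B f => f) (fun A B f g e => e)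
    (fun A => ceq_refl (cid A)) (fun X Y Z g f => ceq_refl (ccomp g f)).

Definition functor_comp (C D E : category) (G : functor D E)
  (F : functor C D) : functor C E.
Proof.
refine (@Functor C E (fun A => G (F A)) (fun A B f => fmap G (fmap F f))
  _ _ _).
- by move=> A B f g e; do 2!apply: fmap_ceq.
- move=> A; exact: ceq_trans (fmap_ceq G (fmap_id F A)) (fmap_id G _).
- move=> X Y Z g f.
  exact: ceq_trans (fmap_ceq G (fmap_comp F g f)) (fmap_comp G _ _).
Defined.

Definition naturally_isomorphic (C D : category) (F G : functor C D) :=
  exists (s : forall A, cmor D (F A) (G A)) (t : forall A, cmor D (G A) (F A)),
    [/\ forall A B (f : cmor C A B),
          ceq (ccomp (s B) (fmap F f)) (ccomp (fmap G f) (s A)),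
        forall A, ceq (ccomp (s A) (t A)) (cid (G A)) &
        forall A, ceq (ccomp (t A) (s A)) (cid (F A))].

Definition equivalent (C D : category) :=
  exists (F : functor C D) (G : functor D C),
    naturally_isomorphic (functor_comp G F) (functor_id C) /\
    naturally_isomorphic (functor_comp F G) (functor_id D).

Definition self_dual (C : category) := equivalent C (opposite C).

Record dom (d : Order.disp_t) (Q : quantaleType d)
    (Phi : limit_weights Q) := MkDom {
  domcat :> qcat Q;
  dom_cocomplete : J_cocomplete Phi domcat;
  dom_continuous : J_continuous Phi domcat;
  dom_determined : open_module_determined Phi domcat
}.

Record domfun (d : Order.disp_t) (Q : quantaleType d)
    (Phi : limit_weights Q) (X Y : qcat Q) := MkDomfun {
  domfun_val :> qfun X Y;
  domfun_reflects : reflects_open Phi domfun_val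
}.

Lemma domfun_ext (d : Order.disp_t) (Q : quantaleType d)
    (Phi : limit_weights Q) (X Y : qcat Q) (f g : domfun Phi X Y) :
  (forall x, f x = g x) -> f = g.
Proof.
case: f g => [f fP] [g gP] /= /qfun_ext eq_fg; subst g.
by rewrite (Prop_irrelevance fP gP).
Qed.

Definition domfun_id (d : Order.disp_t) (Q : quantaleType d)
  (Phi : limit_weights Q) (X : qcat Q) : domfun Phi X X.
Proof.
exists (qfun_id X) => a; have -> // : qcomp a (qfun_id X) = a.
exact: qfun_ext.
Defined.

Definition domfun_comp (d : Order.disp_t) (Q : quantaleType d)
  (Phi : limit_weights Q) (X Y Z : qcat Q) (g : domfun Phi Y Z)
  (f : domfun Phi X Y) : domfun Phi X Z.
Proof.
exists (qcomp g f) => a openA.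
have -> : qcomp a (qcomp g f) = qcomp (qcomp a g) f by exact: qfun_ext.
by apply: domfun_reflects; apply: domfun_reflects.
Defined.

Lemma isoob_trans (d : Order.disp_t) (Q : quantaleType d) (X : qcat Q)
    (x y z : X) : isoob x y -> isoob y z -> isoob x z.
Proof.
have le1 (u v w : X) : 𝟏 <= hom X u v -> 𝟏 <= hom X v w -> 𝟏 <= hom X u w.
  move=> uv vw; apply: le_trans (hom_comp u v w).
  by rewrite -[leLHS]qtens1; apply: qtens_mono.
by move=> [xy yx] [yz zy]; split; [exact: le1 yz|exact: le1 yx].
Qed.

Lemma isoob_qfun (d : Order.disp_t) (Q : quantaleType d) (X Y : qcat Q)
    (f g : qfun X Y) :
  @isoob d Q (qfuncat X Y) f g <-> forall x, isoob (f x) (g x).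
Proof.
split=> [[/le_qInf fg /le_qInf gf] x //|fg].
by split; apply/le_qInf => x; have [] := fg x.
Qed.

(* Q-categories need not be separated, and two morphisms are identified when
   they are isomorphic in Y^X.  For separated [Y] this is equality
   ([isoob_separated]).  With literal equality on all objects there is no
   self-duality: already for Q = {0, 1} and no weights, the one-point category
   is terminal, but there is no initial object, as all objects are nonempty
   and all 2 ^ #|X| maps from X to the indiscrete category on two points are
   morphisms.  [sepDom] below is the version for separated objects, with
   literal equality of morphisms. *)
Definition Dom (d : Order.disp_t) (Q : quantaleType d)
  (Phi : limit_weights Q) : category.
Proof.
refine (@Category (dom Phi) (fun X Y => domfun Phi X Y)
  (fun X Y f g => @isoob d Q (qfuncat X Y) f g)
  (fun X => domfun_id Phi X) (fun X Y Z g f => domfun_comp g f)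
  _ _ _ _ _ _ _) => /=.
- by move=> X Y f; split; exact: (@hom_id d Q (qfuncat X Y)).
- by move=> X Y f g [].
- by move=> X Y f g h; exact: isoob_trans.
- move=> X Y Z g g' f f' /isoob_qfun eg /isoob_qfun ef; apply/isoob_qfun => x.
  apply: isoob_trans (eg (f' x)); have [le ge] := ef x.
  by split; apply: le_trans (qmap_hom g _ _).
- by move=> X Y f; apply/isoob_qfun => x; split; exact: hom_id.
- by move=> X Y f; apply/isoob_qfun => x; split; exact: hom_id.
- by move=> X Y Z T h g f; apply/isoob_qfun => x; split; exact: hom_id.
Defined.

Lemma isoob_separated (d : Order.disp_t) (Q : quantaleType d)
    (Phi : limit_weights Q) (X Y : qcat Q) (f g : domfun Phi X Y) :
  separated Y -> @isoob d Q (qfuncat X Y) f g <-> f = g.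
Proof.
move=> sepY; split=> [/isoob_qfun fg|->].
  by apply: domfun_ext => x; exact: sepY.
by split; exact: (@hom_id d Q (qfuncat X Y)).
Qed.

Definition sepDom (d : Order.disp_t) (Q : quantaleType d)
  (Phi : limit_weights Q) : category.
Proof.
refine (@Category {X : dom Phi | separated X}
  (fun X Y => domfun Phi (sval X) (sval Y)) (fun X Y f g => f = g)
  (fun X => domfun_id Phi (sval X)) (fun X Y Z g f => domfun_comp g f)
  _ _ _ _ _ _ _) => /=.
- by [].
- by [].
- by move=> X Y f g h -> ->.
- by move=> X Y Z g g' f f' -> ->.
- by move=> X Y f; exact: domfun_ext.
- by move=> X Y f; exact: domfun_ext.
- by move=> X Y Z T h g f; exact: domfun_ext.
Defined.

(* Main.v *)
(* The open modules FX form an object of the category, with suprema of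
   J-weighted families computed pointwise and left adjoint
   [b |-> (a |-> ⋁ x, b x ⊗ [a, λ x])]; this uses only the interpolation
   [b x = ⋁ w, ⋁ a, b w ⊗ [a, λ w] ⊗ a x] of open modules, which is open module
   determination combined with J-cocontinuity.  Evaluation [X -> F (F X)] is
   fully faithful, and surjective up to isomorphism because an open module [B]
   on FX is evaluation at the J-weighted colimit of
   [w |-> ⋁ a, B a ⊗ [a, λ w]], which is in J by the same interpolation on FX.
   Precomposition then makes F a contravariant functor which is its own
   pseudo-inverse. *)
Require Import Defs.
From mathcomp Require Import all_boot all_order.
From mathcomp Require Import boolp.
Set Implicit Arguments.
Unset Strict Implicit.
Unset Printing Implicit Defensive.
Import Order.TTheory.
Local Open Scope order_scope.

(** * Order and Yoneda calculus in Q^X *)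

Section Quantale.
Context (d : Order.disp_t) (Q : quantaleType d).
Implicit Types u v w : Q.

Lemma qtensAC u v w : u ⊗ v ⊗ w = u ⊗ w ⊗ v.
Proof. by rewrite -qtensA [v ⊗ w]qtensC qtensA. Qed.

Lemma le_qSup (T : Type) (f : T -> Q) (x : T) w : w <= f x -> w <= ⋁ x, f x.
Proof. by move=> le_w; apply: (le_trans le_w); exact: (qSup_ub f). Qed.

Lemma tens_qSup_le (T : Type) (f : T -> Q) u w :
  (forall x, u ⊗ f x <= w) -> u ⊗ (⋁ x, f x) <= w.
Proof. by move=> h; rewrite qtens_Sup; apply/qSup_le. Qed.

Lemma qSup_tens_le (T : Type) (f : T -> Q) u w :
  (forall x, f x ⊗ u <= w) -> (⋁ x, f x) ⊗ u <= w.
Proof. by move=> h; rewrite qSup_tens; apply/qSup_le. Qed.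

Lemma qInf_res_le (T : Type) (p f : T -> Q) (i : T) :
  p i ⊗ (⋀ i, qres (p i) (f i)) <= f i.
Proof. by apply/le_qres; exact: (qInf_lb (fun i => qres (p i) (f i))). Qed.

Lemma le_qInf_res (T : Type) (p f : T -> Q) u :
  (forall i, p i ⊗ u <= f i) -> u <= ⋀ i, qres (p i) (f i).
Proof. by move=> h; apply/le_qInf => i; apply/le_qres. Qed.

Lemma one_hom_id (X : qcat Q) (x : X) : hom X x x = 𝟏.
Proof. by apply/le_anti; rewrite qone_top hom_id. Qed.

Lemma qfun_le (X : qcat Q) (a : qcopsh X) (x z : X) :
  a x ⊗ hom X x z <= a z.
Proof. by apply/le_qres; exact: (qmap_hom a). Qed.

Lemma qcopsh_hom_le (X : qcat Q) (a b : qcopsh X) (x : X) :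
  a x ⊗ hom (qcopsh X) a b <= b x.
Proof. exact: qInf_res_le. Qed.

Lemma le_qcopsh_hom (X : qcat Q) (a b : qcopsh X) u :
  (forall x, a x ⊗ u <= b x) -> u <= hom (qcopsh X) a b.
Proof. exact: le_qInf_res. Qed.

Lemma qcopsh_yoneda (X : qcat Q) (x : X) (a : qcopsh X) :
  hom (qcopsh X) (lambda x) a = a x.
Proof.
apply/le_anti/andP; split.
  by apply: le_trans (qcopsh_hom_le (lambda x) a x); rewrite /= one_hom_id qtens1.
by apply: le_qcopsh_hom => z; rewrite qtensC; exact: qfun_le.
Qed.

(* [a, λ x] *)
Definition cohom (X : qcat Q) (a : qcopsh X) (x : X) : Q :=
  hom (qcopsh X) a (lambda x).

Lemma cohom_le (X : qcat Q) (a : qcopsh X) (x z : X) :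
  a z ⊗ cohom a x <= hom X x z.
Proof. exact: (qcopsh_hom_le a (lambda x)). Qed.

(** By Yoneda [b x] is [λ x, b], so this bound and the next two are composition in Q^X. *)
Lemma cohom_tens (X : qcat Q) (a b : qcopsh X) (x : X) :
  cohom a x ⊗ b x <= hom (qcopsh X) a b.
Proof.
by rewrite -(qcopsh_yoneda x b); exact: (@hom_comp d Q (qcopsh X)).
Qed.

Lemma cohom_hom (X : qcat Q) (a : qcopsh X) (x x' : X) :
  hom X x' x ⊗ cohom a x <= cohom a x'.
Proof.
have <- : _ = hom X x' x := qcopsh_yoneda x (lambda x').
by rewrite qtensC; exact: (@hom_comp d Q (qcopsh X)).
Qed.

Lemma hom_cohom (X : qcat Q) (a b : qcopsh X) (x : X) :
  hom (qcopsh X) b a ⊗ cohom a x <= cohom b x.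
Proof. exact: (@hom_comp d Q (qcopsh X)). Qed.

End Quantale.

(** * The class J, J-weighted suprema in FX, and the way-below module *)

Section Modules.
Context (d : Order.disp_t) (Q : quantaleType d) (Phi : limit_weights Q).

(** The opposite inequality holds for every module, since [phi i ⊗ ⋀ i, qres (phi i) (a i x)] lies
    below [a i x]. *)
Lemma inJ_le (X : qcat Q) (psi : qmod X) :
  (forall (I : qcat Q) (phi : qfun I (qself Q)), @Phi I phi ->
    forall a : qfun I (qcopsh X),
    (⋀ i : I, qres (phi i) (⋁ x : X, a i x ⊗ psi x)) <=
    ⋁ x : X, (⋀ i : I, qres (phi i) (a i x)) ⊗ psi x) ->
  inJ Phi psi.
Proof.
move=> h; apply/inJE => I phi Phi_phi a; apply/le_anti; rewrite h //=.
apply/qSup_le => x; apply: le_qInf_res => i; apply: (le_qSup (x := x)).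
by rewrite qtensA; apply: qtens_mono => //; exact: qInf_res_le.
Qed.

(* Taking Φ-limits of the weights [x |-> ⋁ y, G i y ⊗ R x y] against [b] is
   allowed since [b] is in J; the interpolation of [b] through [R] and [P] then
   brings the limit of the [G i] themselves back. *)
Lemma transpose_inJ (X Y : qcat Q) (P R : X -> Y -> Q) (b : qcopsh X)
    (n : qmod Y) :
  (forall x x' y, hom X x' x ⊗ R x y <= R x' y) ->
  (forall x y y', R x y' ⊗ P x y <= hom Y y' y) ->
  (forall x, b x <= ⋁ w, ⋁ y, b w ⊗ R w y ⊗ P x y) ->
  (forall y, n y = ⋁ x, b x ⊗ R x y) ->
  inJ Phi (qmod_op b) -> inJ Phi n.
Proof.
move=> Rx RP bRP nE /inJE Jb; apply: inJ_le => I phi Phi_phi G.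
have HP i x z : hom (opcat X) x z <=
    hom (qself Q) (⋁ y, G i y ⊗ R x y) (⋁ y, G i y ⊗ R z y).
  apply/le_qres; apply: qSup_tens_le => y; apply: (le_qSup (x := y)).
  by rewrite -qtensA; apply: qtens_mono => //; rewrite qtensC; exact: Rx.
pose H0 i : qcopsh (opcat X) := @QFun d Q (opcat X) (qself Q) _ (HP i).
have H0P i j : hom I i j <= hom (qcopsh (opcat X)) (H0 i) (H0 j).
  apply: (le_trans (qmap_hom G i j)); apply: le_qcopsh_hom => x.
  apply: qSup_tens_le => y; apply: (le_qSup (x := y)).
  by rewrite qtensAC; apply: qtens_mono => //; exact: qcopsh_hom_le.
have := Jb I phi Phi_phi (@QFun d Q I (qcopsh (opcat X)) H0 H0P).
have -> : (⋀ i, qres (phi i) (⋁ y, G i y ⊗ n y)) =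
    ⋀ i, qres (phi i) (⋁ x : opcat X, H0 i x ⊗ qmod_op b x).
  apply: eq_qInf => i; congr qres.
  under [RHS]eq_qSup => x do rewrite /= qSup_tens.
  rewrite exchange_qSup; apply: eq_qSup => y.
  rewrite nE qtens_Sup; apply: eq_qSup => x.
  by rewrite [b x ⊗ _]qtensC qtensA.
move=> /= ->; apply/qSup_le => x.
apply: (le_trans (qtens_monor _ (bRP x))).
apply: tens_qSup_le => w; apply: tens_qSup_le => y; apply: (le_qSup (x := y)).
rewrite [_ ⊗ P x y]qtensC qtensA; apply: qtens_mono; last first.
  by rewrite nE; exact: (le_qSup (x := w)).
apply: le_qInf_res => i; rewrite qtensA.
apply: (le_trans (qtens_mono (qInf_res_le _ _ i) (lexx _))).
apply: qSup_tens_le => y'; rewrite -qtensA.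
by apply: le_trans (qfun_le (G i) y' y); exact: qtens_monor.
Qed.

Definition J_colim (X : qcat Q) (Psi : qmod (Fcat Phi X)) : qcopsh X.
Proof.
refine (@QFun d Q X (qself Q) (fun x => ⋁ a : Fcat Phi X, sval a x ⊗ Psi a) _).
move=> x z; apply/le_qres; apply: qSup_tens_le => a; apply: (le_qSup (x := a)).
by rewrite qtensAC; apply: qtens_mono => //; exact: qfun_le.
Defined.

(** Cocontinuity holds because suprema commute. For membership in J, a Φ-limit passes first through
    the supremum over [a], as [Psi] is in J, and then through the one over [x], as each [a] is in
    J. *)
Lemma J_colim_open (X : qcat Q) (Psi : qmod (Fcat Phi X)) :
  inJ Phi Psi -> open_module Phi (J_colim Psi).
Proof.
move=> /inJE JPsi; split.
  move=> I psi Jpsi D c colim; apply/wcolim_qself => /=.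
  under [RHS]eq_qSup => i do rewrite qSup_tens.
  rewrite exchange_qSup; apply: eq_qSup => -[a [coc Ja]] /=.
  have /wcolim_qself -> := coc I psi Jpsi D c colim.
  by rewrite qSup_tens; apply: eq_qSup => i; rewrite qtensAC.
apply: inJ_le => I phi Phi_phi b.
have HP i a a' : hom (Fcat Phi X) a a' <= hom (qself Q)
    (⋁ x : X, b i x ⊗ sval a x) (⋁ x : X, b i x ⊗ sval a' x).
  apply/le_qres; apply: qSup_tens_le => x; apply: (le_qSup (x := x)).
  by rewrite -qtensA; apply: qtens_monor; exact: qcopsh_hom_le.
pose H0 i : qcopsh (Fcat Phi X) := @QFun d Q (Fcat Phi X) (qself Q) _ (HP i).
have H0P i j : hom I i j <= hom (qcopsh (Fcat Phi X)) (H0 i) (H0 j).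
  apply: (le_trans (qmap_hom b i j)); apply: le_qcopsh_hom => a.
  apply: qSup_tens_le => x; apply: (le_qSup (x := x)).
  by rewrite qtensAC; apply: qtens_mono => //; exact: qcopsh_hom_le.
have := JPsi I phi Phi_phi (@QFun d Q I (qcopsh (Fcat Phi X)) H0 H0P).
have -> : (⋀ i, qres (phi i) (⋁ x : opcat X, b i x ⊗ qmod_op (J_colim Psi) x)) =
    ⋀ i, qres (phi i) (⋁ a : Fcat Phi X, H0 i a ⊗ Psi a).
  apply: eq_qInf => i; congr qres => /=.
  under eq_qSup => x do rewrite qtens_Sup.
  rewrite exchange_qSup; apply: eq_qSup => a.
  by rewrite qSup_tens; apply: eq_qSup => x; rewrite qtensA.
move=> /= ->; apply/qSup_le => a.
have /inJE Ja := (svalP a).2.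
rewrite (Ja I phi Phi_phi b) /=; apply: qSup_tens_le => x.
apply: (le_qSup (x := x)); rewrite -qtensA; apply: qtens_monor.
exact: (le_qSup (x := a)).
Qed.

Definition F_S (X : qcat Q) : qfun (Jcat Phi (Fcat Phi X)) (Fcat Phi X).
Proof.
refine (@QFun d Q (Jcat Phi (Fcat Phi X)) (Fcat Phi X)
  (fun Psi => exist _ (J_colim (sval Psi)) (J_colim_open (svalP Psi))) _).
move=> Psi Psi'; apply: le_qcopsh_hom => x /=.
apply: qSup_tens_le => a; apply: (le_qSup (x := a)); rewrite -qtensA.
by apply: qtens_monor; exact: (qcopsh_hom_le (sval Psi) (sval Psi')).
Defined.

Lemma F_S_adjoint (X : qcat Q) : adjoint (F_S X) (yonedaJ Phi (Fcat Phi X)).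
Proof.
move=> [Psi JPsi] b /=.
transitivity (⋀ x : X, ⋀ a : Fcat Phi X,
    qres (Psi a) (qres (sval a x) (sval b x))).
  apply: eq_qInf => x; rewrite qSup_res; apply: eq_qInf => a.
  by rewrite qres_res qtensC.
by rewrite exchange_qInf; apply: eq_qInf => a; rewrite qres_Inf.
Qed.

Definition ev (X : qcat Q) (x : X) : qcopsh (Fcat Phi X).
Proof.
refine (@QFun d Q (Fcat Phi X) (qself Q) (fun a => sval a x) _) => a b.
by apply/le_qres; exact: qcopsh_hom_le.
Defined.

Lemma ev_cocontinuous (X : qcat Q) (x : X) : J_cocontinuous Phi (ev x).
Proof. by apply: (J_cocontinuousE (ev x) (@F_S_adjoint X)).2. Qed.

(* The right-hand side of open module determination, which avoids choosing [S]
   as [waybelow] does. *)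
Definition wb (X : qcat Q) (x y : X) : Q :=
  ⋁ a : Fcat Phi X, sval a y ⊗ cohom (sval a) x.

Lemma wb_hom (X : qcat Q) (x y : X) : wb x y <= hom X x y.
Proof. by apply/qSup_le => a; exact: cohom_le. Qed.

(** This half of open module determination needs no continuity: [a y] ⊗ X(y, S phi) lies below a(S
    phi) = ⋁ z, a z ⊗ phi z, and a z ⊗ [a, λ x] <= X(x, z). *)
Lemma wb_le_waybelow (X : qcat Q) (S : qfun (Jcat Phi X) X) (x y : X) :
  adjoint S (yonedaJ Phi X) -> wb x y <= waybelow S x y.
Proof.
move=> adjS; apply/qSup_le => -[a [coc Ja]] /=; apply: le_qInf_res => phi.
rewrite qtensA [hom _ _ _ ⊗ _]qtensC.
apply: (le_trans (qtens_mono (qfun_le a y (S phi)) (lexx _))).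
rewrite ((J_cocontinuousE a adjS).1 coc); apply: qSup_tens_le => z.
rewrite qtensAC.
apply: (le_trans (qtens_mono (cohom_le _ _ _) (lexx _))).
by rewrite qtensC; exact: (@qfun_le d Q (opcat X) (sval phi) z x).
Qed.

(** [J_cocomplete], [J_continuous] and [open_module_determined] each come with their own [S]; this
    allows passing between them. *)
Lemma adjoint_yonedaJ_hom (X : qcat Q) (S S' : qfun (Jcat Phi X) X)
    (y : X) (phi : Jcat Phi X) :
  adjoint S (yonedaJ Phi X) -> adjoint S' (yonedaJ Phi X) ->
  hom X y (S phi) = hom X y (S' phi).
Proof.
have le S1 S2 : adjoint S1 (yonedaJ Phi X) -> adjoint S2 (yonedaJ Phi X) ->
    hom X y (S1 phi) <= hom X y (S2 phi).
  move=> adj1 adj2; apply: le_trans (hom_comp y (S1 phi) (S2 phi)).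
  rewrite -[leLHS]qtens1 qtensC; apply: qtens_monor.
  by rewrite adj1 -adj2 hom_id.
by move=> adjS adjS'; apply/le_anti; rewrite !le.
Qed.

(** The infimum is attained at [phi := L y], where the unit gives X(y, S (L y)) = 𝟏. *)
Lemma left_adjoint_waybelow (X : qcat Q) (S : qfun (Jcat Phi X) X)
    (L : qfun X (Jcat Phi X)) (x y : X) :
  adjoint L S -> waybelow S x y = sval (L y) x.
Proof.
move=> adjL; apply/le_anti/andP; split.
  apply: (le_trans (qInf_lb _ (L y))); rewrite -adjL one_hom_id qres1l.
  exact: lexx.
apply: le_qInf_res => phi; rewrite -adjL qtensC.
exact: (qcopsh_hom_le (sval (L y)) (sval phi)).
Qed.

End Modules.

(** * FX as an object of the category *)

Section DomObject.
Context (d : Order.disp_t) (Q : quantaleType d) (Phi : limit_weights Q).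
Implicit Types X : dom Phi.

(** Here [cid] is the choice of a witness, not a categorical identity. *)
Definition dom_S X : qfun (Jcat Phi X) X := sval (cid (dom_cocomplete X)).

Lemma dom_S_adjoint X : adjoint (dom_S X) (yonedaJ Phi X).
Proof. by rewrite /dom_S; case: cid. Qed.

(** [L] is the value at [y] of a left adjoint given by continuity; determination computes it as
    wb(-, y), which is thereby in J. *)
Lemma dom_wb X (y : X) : exists L : Jcat Phi X,
  (forall x : X, sval L x = wb Phi x y) /\
  forall phi, hom (Jcat Phi X) L phi = hom X y (dom_S X phi).
Proof.
have [S adjS [L adjL]] := dom_continuous X.
exists (L y); split=> [x|phi].
  rewrite -(@left_adjoint_waybelow d Q Phi X S L x y adjL).
  exact: (dom_determined adjS x y).
by rewrite adjL (adjoint_yonedaJ_hom _ _ adjS (@dom_S_adjoint X)).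
Qed.

Lemma open_S X (a : Fcat Phi X) (phi : Jcat Phi X) :
  sval a (dom_S X phi) = ⋁ x : X, sval a x ⊗ sval phi x.
Proof.
by case: a => a [coc Ja]; apply: ((J_cocontinuousE a (@dom_S_adjoint X)).1 coc).
Qed.

Lemma open_wb X (a : Fcat Phi X) (y : X) :
  sval a y = ⋁ x : X, sval a x ⊗ wb Phi x y.
Proof.
apply/le_anti/andP; split; last first.
  rewrite -[leRHS]hom_act; apply/qSup_le => x; apply: (le_qSup (x := x)).
  by apply: qtens_monor; exact: wb_hom.
have [L [LE Lhom]] := dom_wb y.
(* The unit 𝟏 <= X(y, S L) is [Lhom] at [phi := L]. *)
have le_y : sval a y <= sval a (dom_S X L).
  apply/qone_res; apply: le_trans (qmap_hom (sval a) _ _).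
  by rewrite -Lhom hom_id.
apply: (le_trans le_y); rewrite open_S.
by apply/qSup_le => x; apply: (le_qSup (x := x)); rewrite LE.
Qed.

Lemma open_interpolation X (b : Fcat Phi X) (x : X) :
  sval b x = ⋁ w : X, ⋁ a : Fcat Phi X,
    sval b w ⊗ cohom (sval a) w ⊗ sval a x.
Proof.
rewrite open_wb; apply: eq_qSup => w; rewrite qtens_Sup; apply: eq_qSup => a.
by rewrite [sval a x ⊗ _]qtensC qtensA.
Qed.

(** The transposition argument of [transpose_inJ], with the J-module wb(-, x) in the role of [b];
    its definition as a supremum over [a] supplies the interpolation. *)
Lemma ev_inJ X (x : X) : inJ Phi (qmod_op (ev Phi x)).
Proof.
apply: inJ_le => I phi Phi_phi G /=.
have [[L JL] [/= LE _]] := dom_wb x; move: JL => /inJE JL.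
have KP i y z : hom X y z <= hom (qself Q)
    (⋁ a : Fcat Phi X, G i a ⊗ sval a y) (⋁ a : Fcat Phi X, G i a ⊗ sval a z).
  apply/le_qres; apply: qSup_tens_le => a; apply: (le_qSup (x := a)).
  by rewrite -qtensA; apply: qtens_monor; exact: qfun_le.
pose K0 i : qcopsh X := @QFun d Q X (qself Q) _ (KP i).
have K0P i j : hom I i j <= hom (qcopsh X) (K0 i) (K0 j).
  apply: (le_trans (qmap_hom G i j)); apply: le_qcopsh_hom => y.
  apply: qSup_tens_le => a; apply: (le_qSup (x := a)).
  by rewrite qtensAC; apply: qtens_mono => //; exact: qcopsh_hom_le.
have := JL I phi Phi_phi (@QFun d Q I (qcopsh X) K0 K0P).
have -> : (⋀ i, qres (phi i) (⋁ y : X, K0 i y ⊗ L y)) =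
    ⋀ i, qres (phi i) (⋁ a : opcat (Fcat Phi X), G i a ⊗ sval a x).
  apply: eq_qInf => i; congr qres => /=.
  under eq_qSup => y do rewrite qSup_tens.
  rewrite exchange_qSup; apply: eq_qSup => a.
  rewrite (open_wb a x) qtens_Sup; apply: eq_qSup => y.
  by rewrite LE qtensA.
move=> ->; apply/qSup_le => w; rewrite LE; apply: tens_qSup_le => a.
apply: (le_qSup (x := a)); rewrite [sval a x ⊗ _]qtensC qtensA.
apply: qtens_mono => //; apply: le_qInf_res => i; rewrite qtensA.
apply: (le_trans (qtens_mono (qInf_res_le _ _ i) (lexx _))) => /=.
apply: qSup_tens_le => c; rewrite -qtensA.
apply: le_trans (@qfun_le d Q (opcat (Fcat Phi X)) (G i) c a).
by apply: qtens_monor; rewrite qtensC; exact: cohom_tens.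
Qed.

Lemma ev_open X (x : X) : open_module Phi (ev Phi x).
Proof. by split; [exact: ev_cocontinuous|exact: ev_inJ]. Qed.

Definition F_below X (b : Fcat Phi X) : qmod (Fcat Phi X).
Proof.
refine (@QFun d Q (opcat (Fcat Phi X)) (qself Q)
  (fun a => ⋁ x : X, sval b x ⊗ cohom (sval a) x) _) => a c.
apply/le_qres; apply: qSup_tens_le => x; apply: (le_qSup (x := x)).
rewrite -qtensA; apply: qtens_monor; rewrite qtensC.
exact: hom_cohom.
Defined.

Lemma F_below_inJ X (b : Fcat Phi X) : inJ Phi (F_below b).
Proof.
apply: (@transpose_inJ d Q Phi X (Fcat Phi X) (fun x a => sval a x)
  (fun x a => cohom (sval a) x) (sval b)) => //.
- by move=> x x' a; exact: cohom_hom.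
- by move=> x a a'; exact: cohom_tens.
- by move=> x; rewrite -open_interpolation.
- by case: b => b [].
Qed.

Definition F_L X : qfun (Fcat Phi X) (Jcat Phi (Fcat Phi X)).
Proof.
refine (@QFun d Q (Fcat Phi X) (Jcat Phi (Fcat Phi X))
  (fun b => exist _ (F_below b) (F_below_inJ b)) _) => b c.
apply: (@le_qcopsh_hom d Q (opcat (Fcat Phi X))) => a /=.
apply: qSup_tens_le => x; apply: (le_qSup (x := x)).
by rewrite qtensAC; apply: qtens_mono => //; exact: qcopsh_hom_le.
Defined.

Lemma F_L_adjoint X : adjoint (F_L X) (F_S Phi X).
Proof.
move=> b [Psi JPsi]; apply/le_anti/andP; split.
  (* Interpolating [b x] produces the terms b w ⊗ [a, λ w] of [F_below b a], which the hom carries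
     below [Psi a]. *)
  apply: le_qcopsh_hom => x /=; rewrite open_interpolation.
  apply: qSup_tens_le => w; apply: qSup_tens_le => a; apply: (le_qSup (x := a)).
  rewrite [_ ⊗ sval a x]qtensC -qtensA; apply: qtens_monor.
  apply: le_trans (qcopsh_hom_le (F_below b) Psi a).
  by apply: qtens_mono => //=; exact: (le_qSup (x := w)).
(* Conversely, [a, λ x] ⊗ c x <= [a, c], and [Psi] is contravariant. *)
apply: (@le_qcopsh_hom d Q (opcat (Fcat Phi X))) => a /=.
apply: qSup_tens_le => x; rewrite qtensAC.
apply: (le_trans (qtens_mono (qcopsh_hom_le (sval b) (J_colim Psi) x) (lexx _))).
apply: qSup_tens_le => c; rewrite qtensC qtensA.
apply: (le_trans (qtens_mono (cohom_tens _ _ _) (lexx _))).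
by rewrite qtensC; exact: (@qfun_le d Q (opcat (Fcat Phi X)) Psi c a).
Qed.

Lemma F_determined X : open_module_determined Phi (Fcat Phi X).
Proof.
move=> S adjS a b; apply/le_anti/andP; split; last exact: wb_le_waybelow.
have -> : waybelow S a b = waybelow (F_S Phi X) a b.
  apply: eq_qInf => phi; congr qres.
  exact: adjoint_yonedaJ_hom _ _ adjS (@F_S_adjoint d Q Phi X).
rewrite (left_adjoint_waybelow a b (@F_L_adjoint X)) /=.
(* Evaluations suffice among the open modules on FX, because [a, λ x] <= [ev x, λ a]. *)
apply/qSup_le => x; apply: (le_qSup (x := exist _ (ev Phi x) (ev_open x))).
apply: qtens_monor; apply: le_qInf_res => c /=.
by rewrite qtensC; exact: cohom_tens.
Qed.

Definition F_dom X : dom Phi.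
Proof.
refine (@MkDom d Q Phi (Fcat Phi X) _ _ (@F_determined X)).
  by exists (F_S Phi X); exact: F_S_adjoint.
exists (F_S Phi X); first exact: F_S_adjoint.
by exists (F_L X); exact: F_L_adjoint.
Defined.

(** * Separatedness of FX and evaluation into F (F X) *)

Lemma Fcat_ext X (a b : Fcat Phi X) :
  (forall x, sval a x = sval b x) -> a = b.
Proof.
case: a b => [a Ja] [b Jb] /= eq_ab; have {}eq_ab : a = b by exact: qfun_ext.
by subst b; rewrite (Prop_irrelevance Ja Jb).
Qed.

Lemma Fcat_separated X : separated (Fcat Phi X).
Proof.
move=> a b ab; apply: Fcat_ext => x; congr (qmap _ x).
exact: (separated_qfuncat (@separated_qself d Q)) ab.
Qed.

(** Since [ev x] determines wb(-, x), [ev x, ev z] lies below [wb(-, x), wb(-, z)] = X(x, S wb(-,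
    z)), and S wb(-, z) lies below [z]. *)
Lemma ev_hom X (x z : X) :
  hom (qcopsh (Fcat Phi X)) (ev Phi x) (ev Phi z) = hom X x z.
Proof.
apply/le_anti/andP; split; last first.
  by apply: le_qcopsh_hom => a; exact: (qfun_le (sval a)).
have [Lx [LxE Lx_hom]] := dom_wb x; have [Lz [LzE _]] := dom_wb z.
have le_hom : hom X x (dom_S X Lz) <= hom X x z.
  apply: le_trans (hom_comp x (dom_S X Lz) z).
  rewrite -[leLHS]qtens1 qtensC; apply: qtens_monor.
  rewrite dom_S_adjoint; apply/le_qInf => w.
  by apply/qone_res; rewrite LzE; exact: wb_hom.
apply: le_trans le_hom; rewrite -Lx_hom.
apply: (@le_qcopsh_hom d Q (opcat X)) => w; rewrite LxE LzE.
apply: qSup_tens_le => a; apply: (le_qSup (x := a)).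
rewrite qtensAC; apply: qtens_mono => //.
exact: (qcopsh_hom_le (ev Phi x) (ev Phi z) a).
Qed.

Definition F_trace X (B : Fcat Phi (Fcat Phi X)) : qmod X.
Proof.
refine (@QFun d Q (opcat X) (qself Q)
  (fun w => ⋁ a : Fcat Phi X, sval B a ⊗ cohom (sval a) w) _) => w z.
apply/le_qres; apply: qSup_tens_le => a; apply: (le_qSup (x := a)).
rewrite -qtensA; apply: qtens_monor; rewrite qtensC.
exact: (@cohom_hom d Q X (sval a) w z).
Defined.

(** The interpolation of [a] exhibits it as the supremum in FX of [F_below a], and [B] preserves
    this supremum. *)
Lemma F_interpolation X (B : Fcat Phi (F_dom X)) (a : Fcat Phi X) :
  sval B a = ⋁ b : Fcat Phi X, ⋁ x : X,
    sval B b ⊗ cohom (sval b) x ⊗ sval a x.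
Proof.
have aE : a = F_S Phi X (F_L X a).
  apply: Fcat_ext => x /=; rewrite open_interpolation exchange_qSup.
  apply: eq_qSup => b; rewrite qtens_Sup; apply: eq_qSup => w.
  by rewrite [sval b x ⊗ _]qtensC.
rewrite {1}aE ((J_cocontinuousE (sval B) (@F_S_adjoint d Q Phi X)).1 (svalP B).1).
apply: eq_qSup => b; rewrite qtens_Sup; apply: eq_qSup => x.
by rewrite [sval a x ⊗ _]qtensC qtensA.
Qed.

(** The kernels are those of [F_below_inJ], with the roles of X and FX exchanged. *)
Lemma F_trace_inJ X (B : Fcat Phi (F_dom X)) : inJ Phi (F_trace B).
Proof.
apply: (@transpose_inJ d Q Phi (Fcat Phi X) X (fun a x => sval a x)
  (fun a x => cohom (sval a) x) (sval B)) => //.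
- by move=> a b x; exact: hom_cohom.
- by move=> a x w; rewrite qtensC; exact: cohom_le.
- by move=> a; rewrite -F_interpolation.
- exact: (svalP B).2.
Qed.

Definition ev_inv X (B : Fcat Phi (F_dom X)) : X :=
  dom_S X (exist _ (F_trace B) (F_trace_inJ B)).

(** Each open [a] preserves the supremum [ev_inv B], so its value there is ⋁ x, a x ⊗ F_trace B x,
    the interpolation of B at [a]. *)
Lemma ev_ev_inv X (B : Fcat Phi (F_dom X)) : ev Phi (ev_inv B) = sval B.
Proof.
apply: qfun_ext => a; rewrite F_interpolation [LHS]open_S exchange_qSup.
apply: eq_qSup => x /=; rewrite qtens_Sup; apply: eq_qSup => b.
by rewrite qtensC.
Qed.

Lemma open_of_FF X (B : qcopsh (Fcat Phi X)) :
  open_module Phi B -> exists x : X, B = ev Phi x.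
Proof.
move=> openB; exists (ev_inv (exist _ B openB : Fcat Phi (F_dom X))).
by rewrite ev_ev_inv.
Qed.

(** * Precomposition and evaluation as morphisms *)

Lemma qcomp_hom (X Y : qcat Q) (f : qfun X Y) (a b : qcopsh Y) :
  hom (qcopsh Y) a b <= hom (qcopsh X) (qcomp a f) (qcomp b f).
Proof. by apply: le_qcopsh_hom => x; exact: (qcopsh_hom_le a b (f x)). Qed.

Definition F_map X (Y : dom Phi) (f : domfun Phi X Y) :
  domfun Phi (F_dom Y) (F_dom X).
Proof.
exists (@QFun d Q (Fcat Phi Y) (Fcat Phi X)
  (fun a => exist _ (qcomp (sval a) f) (domfun_reflects f (svalP a)))
  (fun a b => qcomp_hom f (sval a) (sval b))).
(* Open modules on FX are evaluations, and [ev x] pulls back to [ev (f x)]. *)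
move=> B /open_of_FF[x ->].
set g := (X in open_module _ X); have -> : g = ev Phi (f x) by exact: qfun_ext.
exact: ev_open.
Defined.

Definition ev_map X : domfun Phi X (F_dom (F_dom X)).
Proof.
exists (@QFun d Q X (Fcat Phi (F_dom X))
  (fun x => exist _ (ev Phi x) (ev_open x))
  (fun x z => eq_ind_r (fun u => (hom X x z <= u)%O) (lexx _) (ev_hom x z))).
(* [B] is evaluation at some open [a], and composing it with [x |-> ev x] returns [a]. *)
move=> B /(@open_of_FF (F_dom X))[a ->].
set g := (X in open_module _ X); have -> : g = sval a by exact: qfun_ext.
exact: (svalP a).
Defined.

Lemma ev_inv_hom X (B C : Fcat Phi (F_dom X)) :
  hom (Fcat Phi (F_dom X)) B C <= hom X (ev_inv B) (ev_inv C).
Proof. by rewrite -ev_hom !ev_ev_inv. Qed.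

Definition ev_inv_map X : domfun Phi (F_dom (F_dom X)) X.
Proof.
exists (@QFun d Q (Fcat Phi (F_dom X)) X (@ev_inv X) (@ev_inv_hom X)) => a opena.
set g := (X in open_module _ X).
have -> : g = ev Phi (exist _ a opena : F_dom X).
  apply: qfun_ext => B.
  exact: (congr1 (fun h : qcopsh (Fcat Phi X) => h (exist _ a opena))
    (ev_ev_inv B)).
exact: (@ev_open (F_dom X)).
Defined.

(** Only an isomorphism, as X need not be separated; full faithfulness of [ev] reduces it to
    [ev_ev_inv]. *)
Lemma ev_inv_ev X (x : X) : isoob (ev_inv_map X (ev_map X x)) x.
Proof.
have eq_ev : ev Phi (ev_inv_map X (ev_map X x)) = ev Phi x :=
  ev_ev_inv (ev_map X x).
by split; rewrite -ev_hom eq_ev; exact: (@hom_id d Q (qcopsh _)).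
Qed.

Lemma ev_ev_inv_map X (B : F_dom (F_dom X)) :
  ev_map X (ev_inv_map X B) = B.
Proof.
apply: Fcat_ext => a.
exact: (congr1 (fun h : qcopsh (Fcat Phi X) => h a) (ev_ev_inv B)).
Qed.

End DomObject.

(** * Self-duality from a contravariant functor inverse to itself *)

Lemma self_dualI (C : category) (D : C -> C)
    (Dmap : forall A B, cmor C A B -> cmor C (D B) (D A))
    (e : forall A, cmor C A (D (D A))) (e' : forall A, cmor C (D (D A)) A) :
  (forall A B (f g : cmor C A B), ceq f g -> ceq (Dmap A B f) (Dmap A B g)) ->
  (forall A, ceq (Dmap A A (Defs.cid A)) (Defs.cid (D A))) ->
  (forall X Y Z (g : cmor C Y Z) (f : cmor C X Y),
    ceq (Dmap X Z (ccomp g f)) (ccomp (Dmap X Y f) (Dmap Y Z g))) ->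
  (forall A B (f : cmor C A B),
    ceq (ccomp (e B) f) (ccomp (Dmap _ _ (Dmap _ _ f)) (e A))) ->
  (forall A, ceq (ccomp (e A) (e' A)) (Defs.cid (D (D A)))) ->
  (forall A, ceq (ccomp (e' A) (e A)) (Defs.cid A)) ->
  self_dual C.
Proof.
move=> Dceq Did Dcomp e_nat ee' e'e.
pose F : functor C (opposite C) := @Functor C (opposite C) D Dmap Dceq Did Dcomp.
pose G : functor (opposite C) C := @Functor (opposite C) C D
  (fun A B => Dmap B A) (fun A B => Dceq B A) Did
  (fun X Y Z g f => Dcomp Z Y X f g).
exists F, G; split; last first.
  (* An arrow from D (D A) to A in the opposite category is one from A to D (D A) in [C], so [e] and
     [e'] swap roles. *)
  by exists e, e'; split=> [A B f||] //=; apply: ceq_sym; exact: e_nat.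
exists e', e; split=> [A B f||] //=.
(* Naturality of [e'] follows from that of [e]: precompose with [e A] after [e' A], move [e] across
   [f], and cancel [e' B] against [e B]. *)
have t1 : ceq (ccomp (e' B) (Dmap _ _ (Dmap _ _ f)))
    (ccomp (ccomp (e' B) (Dmap _ _ (Dmap _ _ f))) (ccomp (e A) (e' A))).
  apply: ceq_trans (ceq_sym (ccomp_idr _)) _.
  by apply: ceq_comp (ceq_refl _) (ceq_sym (ee' A)).
apply: ceq_trans t1 _; apply: ceq_trans (ccompA _ _ _) _.
apply: ceq_comp (ceq_refl _); apply: ceq_trans (ceq_sym (ccompA _ _ _)) _.
apply: ceq_trans (ceq_comp (ceq_refl _) (ceq_sym (e_nat _ _ f))) _.
apply: ceq_trans (ccompA _ _ _) _.
by apply: ceq_trans (ceq_comp (e'e B) (ceq_refl f)) _; exact: ccomp_idl.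
Qed.

Lemma isoob_refl (d : Order.disp_t) (Q : quantaleType d) (X : qcat Q) (x y : X) :
  x = y -> isoob x y.
Proof. by move=> ->; split; exact: hom_id. Qed.

Theorem theorem3p9 (d : Order.disp_t) (Q : quantaleType d)
    (Phi : limit_weights Q) :
  self_dual (Dom Phi) /\ self_dual (sepDom Phi).
Proof.
split.
  apply: (@self_dualI (Dom Phi) (@F_dom d Q Phi) (@F_map d Q Phi)
    (@ev_map d Q Phi) (@ev_inv_map d Q Phi)).
  - move=> X Y f g /isoob_qfun fg; apply/isoob_qfun => a.
    (* Isomorphic [f] and [g] induce equal precompositions because Q is separated. *)
    apply: isoob_refl; apply: Fcat_ext => x /=.
    have [le ge] := fg x; apply: (@separated_qself d Q).
    by split; apply: le_trans (qmap_hom (sval a) _ _).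
  - move=> X; apply/isoob_qfun => a; apply: isoob_refl; exact: Fcat_ext.
  - move=> X Y Z g f; apply/isoob_qfun => a; apply: isoob_refl; exact: Fcat_ext.
  - move=> X Y f; apply/isoob_qfun => x; apply: isoob_refl; exact: Fcat_ext.
  - move=> X; apply/isoob_qfun => B; apply: isoob_refl; exact: ev_ev_inv_map.
  - move=> X; apply/isoob_qfun => x; exact: ev_inv_ev.
(* Every FX is separated, so F restricts to separated objects; in the last goal separatedness of X
   turns [ev_inv_ev] into an equality. *)
apply: (@self_dualI (sepDom Phi)
  (fun X => exist _ (F_dom (sval X)) (@Fcat_separated d Q Phi (sval X)))
  (fun X Y => @F_map d Q Phi (sval X) (sval Y))
  (fun X => ev_map (sval X)) (fun X => ev_inv_map (sval X))) => /=.
- by move=> X Y f g ->.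
- by move=> X; apply: domfun_ext => a; exact: Fcat_ext.
- by move=> X Y Z g f; apply: domfun_ext => a; exact: Fcat_ext.
- move=> X Y f; apply: domfun_ext => x.
  exact: (@Fcat_ext d Q Phi (F_dom (sval Y))).
- by move=> X; apply: domfun_ext => B; exact: ev_ev_inv_map.
- by move=> X; apply: domfun_ext => x; apply: (svalP X); exact: ev_inv_ev.
Qed.
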